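(* Consider the facility location formulation (FL) of the multi-item inventory lot-sizing problem with supplier selection. Let $X^{ij}_{tk}$ (with $i\in I$, $j\in J$, $t,k\in T$, $t\le k$) be a variable of (FL) for which $$O_j\le (k-t)\, H_i\, d^i_k .$$ Then one can set $X^{ij}_{tk'}=0$ for every $k'$ such that $k\le k'\le NT$ without losing optimality.
   Context: Data: items $I=\{1,\ldots,NI\}$, suppliers $J=\{1,\ldots,NJ\}$, periods $T=\{1,\ldots,NT\}$, demands $d^i_t\ge 0$, and nonnegative time-independent costs: unit purchase prices $P_{ij}$, transaction costs $O_j$ (incurred in each period in which something is purchased from supplier $j$), unit holding costs $H_i$ per period. Demands must be met without backlogging, and there are no initial or final stocks. The variable $X^{ij}_{tk}$, defined for $t\le k$, is the amount of item $i$ purchased from supplier $j$ in period $t$ to satisfy demand of period $k$; $y^j_t$ indicates whether items are purchased from supplier $j$ in period $t$. The facility location formulation (FL) is $$\min\ \sum_{i\in I}\sum_{j\in J}\sum_{t=1}^{NT}\sum_{k=t}^{NT}P_{ij}X^{ij}_{tk}+\sum_{j\in J}\sum_{t=1}^{NT}O_jy^j_t+\sum_{i\in I}\sum_{t=1}^{NT}H_i\Big(\sum_{j\in J}\sum_{u=1}^{t}\sum_{k=t+1}^{NT}X^{ij}_{uk}\Big)$$ subject to $\sum_{j\in J}\sum_{t=1}^kX^{ij}_{tk}=d^i_k$ for $i\in I$, $k\in T$; $X^{ij}_{tk}\le d^i_ky^j_t$ for $i\in I$, $j\in J$, $t\in T$, $k\in\{t,\ldots,NT\}$; $y^j_t\in\{0,1\}$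 for $j\in J$, $t\in T$; $X^{ij}_{tk}\ge 0$ for $i\in I$, $j\in J$, $t\in T$, $k\in\{t,\ldots,NT\}$. ''Without losing optimality'' means that the problem with these variables fixed to zero still has the same optimal value.
   Formalization: The case t = k with O_j = 0 is excluded: there the condition reads 0 ≤ 0 and the claim fails, e.g. one item, one supplier, one period, demand 1 and all costs zero, where fixing X = 0 makes the problem infeasible. *)

(* Defs.v *)
From HB Require Import structures.
From mathcomp Require Import all_boot all_order all_algebra.
Set Implicit Arguments.
Unset Strict Implicit.
Unset Printing Implicit Defensive.
Import Order.TTheory GRing.Theory Num.Theory.
Local Open Scope ring_scope.

(* Items, suppliers and periods are numbered from 0.  Every constraint and cost
   depends on periods only through their order and differences, so the shift
   from {1, ..., NT} to {0, ..., NT - 1} is harmless. *)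
Record lot_sizing_data (R : realFieldType) (NI NJ NT : nat) := LotSizingData {
  demand : 'I_NI -> 'I_NT -> R;
  purchase_price : 'I_NI -> 'I_NJ -> R;
  transaction_cost : 'I_NJ -> R;
  holding_cost : 'I_NI -> R
}.

(* [X s i j t k] is a variable of the formulation only when [t <= k]; its values
   for [k < t] appear neither in the objective nor in the constraints.
   [y s j t] is a Boolean, read as 0 or 1 through [_%:R]. *)
Record fl_assignment (R : realFieldType) (NI NJ NT : nat) := FLAssignment {
  X : 'I_NI -> 'I_NJ -> 'I_NT -> 'I_NT -> R;
  y : 'I_NJ -> 'I_NT -> bool
}.

Definition fl_cost (R : realFieldType) (NI NJ NT : nat)
    (D : lot_sizing_data R NI NJ NT) (s : fl_assignment R NI NJ NT) : R :=
  \sum_(i < NI) \sum_(j < NJ) \sum_(t < NT) \sum_(k < NT | (t <= k)%N)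
      purchase_price D i j * X s i j t k
  + \sum_(j < NJ) \sum_(t < NT) transaction_cost D j * (y s j t)%:R
  + \sum_(i < NI) \sum_(t < NT) holding_cost D i *
      (\sum_(j < NJ) \sum_(u < NT | (u <= t)%N) \sum_(k < NT | (t < k)%N)
         X s i j u k).

Definition fl_feasible (R : realFieldType) (NI NJ NT : nat)
    (D : lot_sizing_data R NI NJ NT) (s : fl_assignment R NI NJ NT) : Prop :=
  [/\ forall (i : 'I_NI) (k : 'I_NT),
        \sum_(j < NJ) \sum_(t < NT | (t <= k)%N) X s i j t k = demand D i k,
      forall (i : 'I_NI) (j : 'I_NJ) (t k : 'I_NT), (t <= k)%N ->
        X s i j t k <= demand D i k * (y s j t)%:R
    & forall (i : 'I_NI) (j : 'I_NJ) (t k : 'I_NT), (t <= k)%N ->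
        0 <= X s i j t k].

Definition optimal_value (R : realFieldType) (S : Type) (feasible : S -> Prop)
    (cost : S -> R) (v : R) : Prop :=
  (exists2 s, feasible s & cost s = v) /\
  (forall s, feasible s -> v <= cost s).

(* Main.v *)
(** Serving period k from supplier j in period t costs P_ij + (k - t) H_i per
    unit, so the ranking of two available sources of an item does not depend on
    the period served.  Hence every feasible solution is dominated by one in
    which each demand has a single source, the cheapest open one.  If the source
    of (i, k) is not (j, t), it can replace (j, t) for all later periods.  If it
    is (j, t), opening supplier j in period k costs O_j and saves at least
    (k - t) H_i d_ik.  There are finitely many single-source solutions, so an
    optimum exists. *)
Require Import Defs.
From HB Require Import structures.
From mathcomp Require Import all_boot all_order all_algebra.
Import Order.TTheory GRing.Theory Num.Theory.
Local Open Scope ring_scope.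

Section SingleSource.
Set Implicit Arguments.
Unset Strict Implicit.
Variables (R : realFieldType) (NI NJ NT : nat) (D : lot_sizing_data R NI NJ NT).

(** A source is a pair of a supplier and a purchase period. The subtraction is truncated, so the
    value is meaningful only for [r.2 <= k]. *)
Definition unit_cost (i : 'I_NI) (k : 'I_NT) (r : 'I_NJ * 'I_NT) : R :=
  purchase_price D i r.1 + (k - r.2)%:R * holding_cost D i.

Lemma sum_ord_between (u k : 'I_NT) :
  (\sum_(t < NT) (u <= t < k) = k - u)%N.
Proof.
rewrite -[RHS]muln1 -sum_nat_const_nat big_geq_mkord.
rewrite (big_ord_widen_cond _ _ (fun=> 1%N) (ltnW (ltn_ord k))) [RHS]big_mkcond.
by apply: eq_bigr => t _ /=; case: andP.
Qed.

(** A unit bought in [u] for [k] is in stock at the end of each [t] with [u <= t < k], hence is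
    counted [k - u] times. *)
Lemma holding_sumE (x : 'I_NT -> 'I_NT -> R) :
  \sum_(t < NT) \sum_(u < NT | (u <= t)%N) \sum_(k < NT | (t < k)%N) x u k =
  \sum_(k < NT) \sum_(u < NT | (u <= k)%N) (k - u)%:R * x u k.
Proof.
transitivity (\sum_(t < NT) \sum_(u < NT) \sum_(k < NT)
                (u <= t < k)%:R * x u k).
  apply: eq_bigr => t _; rewrite big_mkcond; apply: eq_bigr => u _.
  case: leqP => _ /=; last by rewrite big1 // => k _; rewrite mul0r.
  rewrite big_mkcond; apply: eq_bigr => k _.
  by case: ifP; rewrite ?mul1r ?mul0r.
rewrite exchange_big /=.
under eq_bigr do rewrite exchange_big /=.
rewrite exchange_big /=; apply: eq_bigr => k _.
rewrite [RHS]big_mkcond; apply: eq_bigr => u _.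
rewrite -mulr_suml -natr_sum sum_ord_between.
by case: leqP => // /ltnW; rewrite -subn_eq0 => /eqP->; rewrite mul0r.
Qed.

Lemma fl_costE (s : fl_assignment R NI NJ NT) :
  fl_cost D s =
    \sum_(r : 'I_NJ * 'I_NT) transaction_cost D r.1 * (y s r.1 r.2)%:R +
    \sum_(i < NI) \sum_(k < NT) \sum_(r : 'I_NJ * 'I_NT | (r.2 <= k)%N)
      unit_cost i k r * X s i r.1 r.2 k.
Proof.
rewrite /fl_cost addrAC addrC pair_big /=; congr (_ + _).
rewrite -big_split /=; apply: eq_bigr => i _.
rewrite -mulr_sumr [X in _ + _ * X]exchange_big /=.
under [X in _ * X]eq_bigr do rewrite holding_sumE.
rewrite mulr_sumr -big_split /=.
transitivity (\sum_(j < NJ) \sum_(k < NT) \sum_(t < NT | (t <= k)%N)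
                unit_cost i k (j, t) * X s i j t k).
  apply: eq_bigr => j _.
  rewrite (exchange_big_dep predT) //= mulr_sumr -big_split /=.
  apply: eq_bigr => k _; rewrite mulr_sumr -big_split /=.
  by apply: eq_bigr => t _; rewrite mulrDl [_ * holding_cost D i]mulrC mulrA.
rewrite exchange_big /=; apply: eq_bigr => k _.
by rewrite pair_big_dep.
Qed.

Definition single_source (p : {ffun 'I_NI * 'I_NT -> 'I_NJ * 'I_NT})
    (o : {ffun 'I_NJ * 'I_NT -> bool}) : fl_assignment R NI NJ NT :=
  FLAssignment (fun i j t k => demand D i k * (p (i, k) == (j, t))%:R)
    (fun j t => o (j, t)).

(** A zero demand may get an arbitrary source, since it ships nothing and possibly no source is open
    for it. *)
Definition served (p : {ffun 'I_NI * 'I_NT -> 'I_NJ * 'I_NT})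
    (o : {ffun 'I_NJ * 'I_NT -> bool}) :=
  [forall i, forall k : 'I_NT, (demand D i k == 0) ||
     o (p (i, k)) && ((p (i, k)).2 <= k)%N].

(** Used with [F] the unit cost to evaluate the objective, and with [F] constantly 1 to check the
    demand constraint. *)
Lemma served_sum p o i (k : 'I_NT) (F : 'I_NJ * 'I_NT -> R) : served p o ->
  \sum_(r : 'I_NJ * 'I_NT | (r.2 <= k)%N)
      F r * (demand D i k * (p (i, k) == r)%:R) =
  demand D i k * F (p (i, k)).
Proof.
move=> /forallP/(_ i)/forallP/(_ k)/orP[/eqP->|/andP[_ lepk]].
  by rewrite mul0r big1 // => r _; rewrite mul0r mulr0.
rewrite (bigD1 (p (i, k))) //= eqxx mulr1 big1 ?addr0 1?mulrC // => r.
by case/andP=> _; rewrite eq_sym => /negPf->; rewrite !mulr0.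
Qed.

Lemma single_source_cost p o : served p o ->
  fl_cost D (single_source p o) =
    \sum_(r | o r) transaction_cost D r.1 +
    \sum_(i < NI) \sum_(k < NT) demand D i k * unit_cost i k (p (i, k)).
Proof.
move=> pP; rewrite fl_costE; congr (_ + _).
  rewrite [RHS]big_mkcond; apply: eq_bigr => -[j t] _ /=.
  by case: (o _); rewrite ?mulr1 ?mulr0.
apply: eq_bigr => i _; apply: eq_bigr => k _.
by rewrite -(served_sum i k _ pP); apply: eq_bigr => -[].
Qed.

Hypothesis demand_ge0 : forall i t, 0 <= demand D i t.

Lemma single_source_feasible p o :
  served p o -> fl_feasible D (single_source p o).
Proof.
move=> pP; split=> [i k|i j t k letk|i j t k letk] /=; last first.
- by rewrite mulr_ge0.
- move: pP => /forallP/(_ i)/forallP/(_ k)/orP[/eqP->|/andP[op _]].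
    by rewrite !mul0r.
  apply: ler_wpM2l => //; rewrite ler_nat.
  by case: eqP => // <-; rewrite op.
- rewrite pair_big_dep /= -[RHS]mulr1 -(served_sum i k (fun=> 1) pP).
  by apply: eq_bigr => -[j t] _ /=; rewrite mul1r.
Qed.

Hypothesis price_ge0 : forall i j, 0 <= purchase_price D i j.
Hypothesis hold_ge0 : forall i, 0 <= holding_cost D i.

Lemma unit_cost_ge0 i k r : 0 <= unit_cost i k r.
Proof. by rewrite addr_ge0 ?mulr_ge0. Qed.

(** Moving from [k] to [k'] adds the same [(k' - k) * holding_cost D i] to both sides, as both
    purchases precede or coincide with [k]. *)
Lemma le_unit_cost i (k k' : 'I_NT) (q r : 'I_NJ * 'I_NT) :
  (q.2 <= k)%N -> (r.2 <= k)%N -> (k <= k')%N ->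
  unit_cost i k q <= unit_cost i k r -> unit_cost i k' q <= unit_cost i k' r.
Proof.
move=> leqk lerk lekk'; rewrite /unit_cost.
have E (z : 'I_NT) : (z <= k)%N -> (k' - z)%N = ((k - z) + (k' - k))%N.
  by move=> lezk; rewrite addnC addnBA // subnK.
by rewrite (E q.2) // (E r.2) // !natrD !mulrDl !addrA lerD2r.
Qed.

Definition cheapest (o : 'I_NJ * 'I_NT -> bool) i (k : 'I_NT) q :=
  [/\ o q, (q.2 <= k)%N &
    forall r, o r -> (r.2 <= k)%N -> unit_cost i k q <= unit_cost i k r].

(** Without an open source up to [k], the linking constraints force every [X] for [k] to 0, hence
    the demand too; [r0] is then a dummy witness. *)
Lemma cheapest_exists s o (r0 : 'I_NJ * 'I_NT) : fl_feasible D s ->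
    (forall r, o r = y s r.1 r.2) ->
  forall i k, exists q, demand D i k = 0 \/ cheapest o i k q.
Proof.
move=> [sumX leX geX] oE i k.
have [r /andP[or lerk]|no_open] := pickP [pred r | o r && (r.2 <= k)%N].
  case: (@arg_minP _ _ _ r [pred r | o r && (r.2 <= k)%N] (unit_cost i k)).
    by rewrite /= or.
  move=> q /andP[oq leqk] minq; exists q; right; split=> // r' or' lerk'.
  by apply: minq; rewrite /= or'.
exists r0; left; rewrite -sumX pair_big_dep big1 //= => -[j t] /= letk.
have /= := no_open (j, t); rewrite letk andbT oE /= => yF.
by apply/eqP; rewrite eq_le geX // andbT; have := leX i j t k letk; rewrite yF mulr0.
Qed.

(** The quantities serving [(i, k)] sum to the demand and vanish at closed sources, so each unit
    costs at least the cheapest open unit cost. *)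
Lemma cheapest_le_cost s o q : fl_feasible D s ->
    (forall r, o r = y s r.1 r.2) ->
    (forall i k, demand D i k = 0 \/ cheapest o i k (q (i, k))) ->
  \sum_(r | o r) transaction_cost D r.1 +
    \sum_(i < NI) \sum_(k < NT) demand D i k * unit_cost i k (q (i, k))
  <= fl_cost D s.
Proof.
move=> [sumX leX geX] oE qP; rewrite fl_costE; apply: lerD.
  rewrite big_mkcond; apply: ler_sum => r _; rewrite oE.
  by case: (y _ _ _); rewrite ?mulr1 ?mulr0.
apply: ler_sum => i _; apply: ler_sum => k _.
have [->|[oq leqk minq]] := qP i k.
  rewrite mul0r; apply: sumr_ge0 => r lerk.
  by rewrite mulr_ge0 ?unit_cost_ge0 ?geX.
rewrite -sumX pair_big_dep /= mulr_suml; apply: ler_sum => r lerk.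
rewrite mulrC; have [yr|yr] := boolP (y s r.1 r.2).
  by rewrite ler_wpM2r ?geX // minq ?oE.
suff -> : X s i r.1 r.2 k = 0 by rewrite !mulr0.
apply/eqP; rewrite eq_le geX // andbT.
by have := leX i r.1 r.2 k lerk; rewrite (negPf yr) mulr0.
Qed.

Hypothesis trans_ge0 : forall j, 0 <= transaction_cost D j.

Definition avoids (i : 'I_NI) (j : 'I_NJ) (t k : 'I_NT)
    (p : {ffun 'I_NI * 'I_NT -> 'I_NJ * 'I_NT}) :=
  [forall k' : 'I_NT, (k <= k')%N ==>
     (demand D i k' == 0) || (p (i, k') != (j, t))].

Lemma single_source_dominates (i : 'I_NI) (j : 'I_NJ) (t k : 'I_NT) s :
    (t < k)%N ->
    transaction_cost D j <= (k - t)%:R * holding_cost D i * demand D i k ->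
    fl_feasible D s ->
  exists p o, [/\ served p o, avoids i j t k p &
                  fl_cost D (single_source p o) <= fl_cost D s].
Proof.
move=> lttk leO sP.
pose o := [ffun r : 'I_NJ * 'I_NT => y s r.1 r.2].
have oE r : o r = y s r.1 r.2 by rewrite ffunE.
have /fin_all_exists[q qP] (ik : 'I_NI * 'I_NT) :
    exists q, demand D ik.1 ik.2 = 0 \/ cheapest o ik.1 ik.2 q.
  exact: (cheapest_exists (j, t) sP oE).
have {}qP (a : 'I_NI) (b : 'I_NT) :
  demand D a b = 0 \/ cheapest o a b (q (a, b)) := qP (a, b).
have les := cheapest_le_cost sP oE qP.
(* Only item [i] from period [k] on is affected, and only where [(j, t)] was used. *)
pose reroute r := [ffun ik : 'I_NI * 'I_NT =>
  if [&& ik.1 == i, (k <= ik.2)%N & q ik == (j, t)] then r else q ik].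
have rerouteE r a b : reroute r (a, b) =
    if [&& a == i, (k <= b)%N & q (a, b) == (j, t)] then r else q (a, b).
  by rewrite ffunE.
have avoidsP r : r != (j, t) -> avoids i j t k (reroute r).
  move=> rjt; apply/forallP => k'; apply/implyP => lekk'.
  rewrite rerouteE eqxx lekk' /=; apply/orP; right.
  by case: ifP => // ->.
(* First case: a nonzero demand with another cheapest source, which takes over from [(j, t)]; no new
   source is opened. *)
have [/andP[dk qik]|] := boolP ((demand D i k != 0) && (q (i, k) != (j, t))).
  have [/eqP|[oq leqk minq]] := qP i k; first by rewrite (negPf dk).
  exists (reroute (q (i, k))), o.
  have pP : served (reroute (q (i, k))) o.
    apply/forallP => a; apply/forallP => b; rewrite rerouteE.
    have [->|[oab leab _]] := qP a b; first by rewrite eqxx.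
    apply/orP; right; case: ifP => [/and3P[_ lekb _]|_]; last by rewrite oab.
    by rewrite oq (leq_trans leqk).
  split=> //; first exact: avoidsP.
  rewrite single_source_cost //; apply: le_trans les; rewrite lerD2l.
  apply: ler_sum => a _; apply: ler_sum => b _; rewrite rerouteE.
  have [->|[oab leab _]] := qP a b; first by rewrite !mul0r.
  apply: ler_wpM2l => //; case: ifP => // /and3P[/eqP eai lekb /eqP qab].
  subst a; rewrite qab in oab leab *; apply: (@le_unit_cost _ k) => //=; first exact: ltnW.
  exact: minq oab (ltnW lttk).
(* Second case: the demand of [(i, k)] is 0 or comes from [(j, t)]; supplier [j] is opened in period
   [k]. *)
rewrite negb_and !negbK => dq.
pose o' := [ffun r => (r == (j, k)) || o r].
exists (reroute (j, k)), o'.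
have pP : served (reroute (j, k)) o'.
  apply/forallP => a; apply/forallP => b; rewrite rerouteE.
  have [->|[oab leab _]] := qP a b; first by rewrite eqxx.
  apply/orP; right; case: ifP => [/and3P[_ lekb _]|_]; first by rewrite ffunE eqxx.
  by rewrite ffunE oab orbT.
split=> //.
  by apply: avoidsP; apply: contraTneq lttk => -[<-]; rewrite ltnn.
rewrite single_source_cost //; apply: le_trans les.
(* Only an inequality, since [(j, k)] may already be open. *)
have leT : \sum_(r | o' r) transaction_cost D r.1 <=
    transaction_cost D j + \sum_(r | o r) transaction_cost D r.1.
  rewrite (bigD1 (j, k)) /=; last by rewrite ffunE eqxx.
  rewrite lerD2l big_mkcond [leRHS]big_mkcond; apply: ler_sum => r _.
  by rewrite ffunE; case: eqP; case: (o r).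
apply: le_trans (lerD leT (lexx _)) _.
rewrite addrAC addrC lerD2l.
(* Same supplier and price, but shorter storage: no term increases. *)
have leC a (b : 'I_NT) : demand D a b * unit_cost a b (reroute (j, k) (a, b)) <=
    demand D a b * unit_cost a b (q (a, b)).
  apply: ler_wpM2l => //; rewrite rerouteE.
  case: ifP => // /and3P[/eqP-> lekb /eqP->].
  by rewrite lerD2l ler_wpM2r // ler_nat leq_sub2l // ltnW.
(* The term of [(i, k)] is isolated: its saving alone has to pay for the new transaction. *)
rewrite (bigD1 i) //= (bigD1 k) //= [leRHS](bigD1 i) //= [X in _ <= X + _](bigD1 k) //=.
rewrite !addrA lerD ?lerD //; [|exact: ler_sum|]; last first.
  by apply: ler_sum => a _; apply: ler_sum.
apply: le_trans (lerD leO (lexx _)) _; rewrite rerouteE eqxx leqnn /=.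
(* For zero demand the bound on the transaction cost is itself 0, so there is nothing to pay. *)
case/orP: dq => [/eqP->|/eqP->]; first by rewrite !mul0r mulr0 addr0.
rewrite eqxx [_ * demand D i k]mulrC -mulrDr ler_wpM2l // /unit_cost /=.
by rewrite subnn mul0r addr0 addrC.
Qed.

End SingleSource.

Theorem proposition2 (R : realFieldType) (NI NJ NT : nat)
    (D : lot_sizing_data R NI NJ NT)
    (demand_ge0 : forall (i : 'I_NI) (t : 'I_NT), 0 <= demand D i t)
    (price_ge0 : forall (i : 'I_NI) (j : 'I_NJ), 0 <= purchase_price D i j)
    (trans_ge0 : forall j : 'I_NJ, 0 <= transaction_cost D j)
    (hold_ge0 : forall i : 'I_NI, 0 <= holding_cost D i)
    (i : 'I_NI) (j : 'I_NJ) (t k : 'I_NT) (le_tk : (t <= k)%N)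
    (nondegenerate : t = k -> 0 < transaction_cost D j)
    (le_trans : transaction_cost D j <=
                (k - t)%:R * holding_cost D i * demand D i k) :
  exists v : R,
    optimal_value (fl_feasible D) (fl_cost D) v /\
    optimal_value
      (fun s => fl_feasible D s /\
         forall k' : 'I_NT, (k <= k')%N -> X s i j t k' = 0)
      (fl_cost D) v.
Proof.
(* If [t = k], the bound gives a transaction cost at most 0, against [nondegenerate]. *)
have lttk : (t < k)%N.
  rewrite ltn_neqAle le_tk andbT; apply/eqP => /val_inj eqtk.
  by move: le_trans (nondegenerate eqtk);
    rewrite eqtk subnn !mul0r leNgt => /negPf->.
have dom s (sP : fl_feasible D s) := @single_source_dominates _ _ _ _ D
  demand_ge0 price_ge0 hold_ge0 trans_ge0 i j t k s lttk le_trans sP.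
(* Buying each demand from [j] in its own period is feasible; by domination the finite set to be
   minimized over is nonempty. *)
pose all_open := single_source D
  [ffun ik : 'I_NI * 'I_NT => (j, ik.2)] [ffun=> true].
have /dom[p0 [o0 [pP0 aP0 _]]] : fl_feasible D all_open.
  apply: single_source_feasible => //; apply/forallP => a; apply/forallP => b.
  by rewrite !ffunE /= leqnn orbT.
pose P (po : {ffun 'I_NI * 'I_NT -> 'I_NJ * 'I_NT} *
             {ffun 'I_NJ * 'I_NT -> bool}) :=
  served D po.1 po.2 && avoids D i j t k po.1.
pose cost (po : {ffun 'I_NI * 'I_NT -> 'I_NJ * 'I_NT} *
             {ffun 'I_NJ * 'I_NT -> bool}) :=
  fl_cost D (single_source D po.1 po.2).
have [|[p o] /andP[/= pP aP] minp] := @arg_minP _ _ _ (p0, o0) P cost.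
  by rewrite /P pP0.
have fP := single_source_feasible demand_ge0 pP.
(* The finite minimum bounds every feasible cost from below; its minimizer satisfies the extra
   zeros, so one value serves both problems. *)
have lb s : fl_feasible D s -> cost (p, o) <= fl_cost D s.
  case/dom => p' [o' [pP' aP']]; apply: Order.le_trans.
  by apply: (minp (p', o')); rewrite /P pP'.
exists (cost (p, o)); split; split; first by exists (single_source D p o).
- exact: lb.
- exists (single_source D p o) => //; split=> // k' lekk' /=.
  move/forallP/(_ k')/implyP/(_ lekk'): aP.
  by case/orP=> [/eqP->|/negPf->]; rewrite ?mul0r ?mulr0.
- by move=> s [/lb].
Qed.
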